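(* Let $V_3$ be the $\mathrm{SL}(2,\mathbb{C})$-character variety of the free group $\mathbb{F}_3=\langle X_1,X_2,X_3\rangle$ of rank three. The map $$\mathsf{t}:V_3\to\mathbb{C}^6,\qquad [\rho]\mapsto\big(t_1(\rho),t_2(\rho),t_3(\rho),t_{12}(\rho),t_{23}(\rho),t_{13}(\rho)\big)$$ is onto. Furthermore it is a double covering branched along the discriminant hypersurface in $\mathbb{C}^6$ defined by $$\begin{aligned}\big(t_{12}t_3+t_{13}t_2+t_{23}t_1-t_1t_2t_3\big)^2=4\Big(&(t_1^2+t_2^2+t_3^2)+(t_{12}^2+t_{23}^2+t_{13}^2)\\&-(t_1t_2t_{12}+t_2t_3t_{23}+t_3t_1t_{13})+t_{12}t_{23}t_{13}-4\Big).\end{aligned}$$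
   Context: For a representation $\rho:\mathbb{F}_3\to\mathrm{SL}(2,\mathbb{C})$ (equivalently a triple $(\rho(X_1),\rho(X_2),\rho(X_3))\in\mathrm{SL}(2,\mathbb{C})^3$) set $t_i(\rho)=\mathrm{tr}(\rho(X_i))$, $t_{ij}(\rho)=\mathrm{tr}(\rho(X_iX_j))$, $t_{ijk}(\rho)=\mathrm{tr}(\rho(X_iX_jX_k))$. The character variety $V_3$ is the quotient, in the sense of Geometric Invariant Theory, of $\mathrm{SL}(2,\mathbb{C})^3$ by simultaneous conjugation; its coordinate ring is the invariant ring $\mathbb{C}[\mathrm{SL}(2,\mathbb{C})^3]^{\mathrm{PSL}(2,\mathbb{C})}$. This ring is generated by $t_1,t_2,t_3,t_{12},t_{23},t_{13},t_{123},t_{132}$, and eliminating $t_{132}$ by $t_{132}=t_{12}t_3+t_{13}t_2+t_{23}t_1-t_1t_2t_3-t_{123}$ realizes $V_3$ as the hypersurface in $\mathbb{C}^7$ (with coordinates $t_1,t_2,t_3,t_{12},t_{23},t_{13},t_{123}$) given by $$\begin{aligned}t_{123}\big(t_{12}t_3+t_{13}t_2+t_{23}t_1-t_1t_2t_3-t_{123}\big)={}&(t_1^2+t_2^2+t_3^2)+(t_{12}^2+t_{23}^2+t_{13}^2)\\&-(t_1t_2t_{12}+t_2t_3t_{23}+t_3t_1t_{13})+t_{12}t_{23}t_{13}-4.\end{aligned}$$ $[\rho]$ denotes the point of $V_3$ determined by $\rho$. *)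

(* Defs.v *)
From HB Require Import structures.
From mathcomp Require Import all_boot all_order all_algebra.
From mathcomp Require Import complex mpoly.
From mathcomp Require Import boolp classical_sets functions cardinality reals.

Set Implicit Arguments.
Unset Strict Implicit.
Unset Printing Implicit Defensive.

Import Order.TTheory GRing.Theory Num.Theory.

Local Open Scope classical_set_scope.
Local Open Scope ring_scope.

(* The real numbers are an arbitrary [R : realType], and C is [R[i]]. *)

Section SL2.
Variable R : realType.

Record SL2 := MkSL2 { SL2_mx :> 'M[R[i]]_2; _ : \det SL2_mx == 1 }.

HB.instance Definition _ := [isSub for SL2_mx].
HB.instance Definition _ := [Choice of SL2 by <:].

Lemma det_SL2 (A : SL2) : \det A = 1.
Proof. exact/eqP/(valP A). Qed.

Fact det_conj_SL2 (g A : SL2) :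
  \det (g *m A *m invmx g) == 1.
Proof. by rewrite !det_mulmx det_inv !det_SL2 invr1 !mulr1. Qed.

Definition conj_SL2 (g A : SL2) : SL2 := MkSL2 (det_conj_SL2 g A).

Fact det_one_SL2 : \det (1%:M : 'M[R[i]]_2) == 1.
Proof. by rewrite det1. Qed.

HB.instance Definition _ := isPointed.Build SL2 (MkSL2 det_one_SL2).

(* A representation of the free group on X_1, X_2, X_3 is given by the images
   of the generators, which are indexed by 0, 1, 2. *)
Definition rep := 'I_3 -> SL2.
HB.instance Definition _ := Pointed.on rep.

Definition conj_rep (g : SL2) (rho : rep) : rep := fun i => conj_SL2 g (rho i).

Definition entries (rho : rep) (k : 'I_#|{: 'I_3 * ('I_2 * 'I_2)}|) : R[i] :=
  let: (i, (a, b)) := enum_val k in rho i a b.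

(* SL(2,C)^3 is a (reduced, closed) subvariety of the affine space of triples
   of matrices, so its coordinate ring is the ring of the functions on it that
   are polynomial in the matrix entries. *)
Definition regular (f : rep -> R[i]) : Prop :=
  exists P : {mpoly R[i][#|{: 'I_3 * ('I_2 * 'I_2)}|]},
    forall rho, f rho = P.@[entries rho].

Definition conj_invariant (f : rep -> R[i]) : Prop :=
  forall g rho, f (conj_rep g rho) = f rho.

Definition inv_regular : {pred rep -> R[i]} :=
  [pred f | `[< regular f /\ conj_invariant f >]].

Lemma inv_regularP (f : rep -> R[i]) :
  reflect (regular f /\ conj_invariant f) (f \in inv_regular).
Proof. exact: asboolP. Qed.

Fact inv_regular_subring : subring_closed inv_regular.
Proof.
split=> [|f h|f h].
- apply/inv_regularP; split=> //; exists 1 => rho.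
  by rewrite meval1.
- move=> /inv_regularP[[P fP] fi] /inv_regularP[[Q hQ] hi].
  apply/inv_regularP; split=> [|g rho]; last first.
    by rewrite !fctE fi hi.
  by exists (P - Q) => rho; rewrite mevalB -fP -hQ.
- move=> /inv_regularP[[P fP] fi] /inv_regularP[[Q hQ] hi].
  apply/inv_regularP; split=> [|g rho]; last first.
    by rewrite !fctE fi hi.
  by exists (P * Q) => rho; rewrite mevalM -fP -hQ.
Qed.

HB.instance Definition _ :=
  GRing.isSubringClosed.Build (rep -> R[i]) inv_regular inv_regular_subring.

Fact inv_regular_scaler : GRing.scaler_closed inv_regular.
Proof.
move=> a f /inv_regularP[[P fP] fi]; apply/inv_regularP; split=> [|g rho].
  by exists (a *: P) => rho; rewrite mevalZ -fP.
by rewrite /GRing.scale /= fi.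
Qed.

HB.instance Definition _ :=
  GRing.isScaleClosed.Build R[i] (rep -> R[i]) inv_regular inv_regular_scaler.

(* The invariant ring C[SL(2,C)^3]^PSL(2,C): conjugation by SL(2,C) factors
   through PSL(2,C), and the two groups have the same invariants. *)
Record inv_ring := InvRing {
  inv_fun :> rep -> R[i];
  _ : inv_fun \in inv_regular }.

HB.instance Definition _ := [isSub for inv_fun].
HB.instance Definition _ := [Choice of inv_ring by <:].
HB.instance Definition _ := [SubChoice_isSubComNzRing of inv_ring by <:].
HB.instance Definition _ := [SubZmodule_isSubLmodule of inv_ring by <:].

Fact inv_ring_scaleAl (a : R[i]) (f h : inv_ring) : a *: (f * h) = a *: f * h.
Proof.
by apply/val_inj/funext => rho; exact: mulrA.
Qed.

HB.instance Definition _ :=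
  GRing.Lmodule_isLalgebra.Build R[i] inv_ring inv_ring_scaleAl.

End SL2.

Section AffineVariety.
Variable R : realType.

(* The points of the affine variety with coordinate ring [A] (the closed points
   of its spectrum) are the C-algebra morphisms from [A] to C. *)
Definition points (A : lalgType R[i]) := {lrmorphism A -> R[i] | *%R}.

Variables (A : lalgType R[i]) (n : nat).

(* Regular functions [a 0, ..., a (n - 1)] define a morphism from [points A]
   to C^n, whose comorphism is [pullback a]. *)
Definition affine_map (a : 'I_n -> A) (x : points A) : 'rV[R[i]]_n :=
  \row_i x (a i).

Definition pullback (a : 'I_n -> A) (p : {mpoly R[i][n]}) : A :=
  mmap (in_alg A) a p.

(* The comorphism makes [A] a free module of rank [d] over the coordinate ring
   of C^n. Over C^n every locally free module of finite rank is free, so this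
   says that the morphism is finite and flat of degree [d]. *)
Definition finite_flat_of_degree (d : nat) (a : 'I_n -> A) : Prop :=
  exists u : 'I_d -> A, forall f : A,
    exists! c : {ffun 'I_d -> {mpoly R[i][n]}},
      f = \sum_(j < d) pullback a (c j) * u j.

Definition fiber (a : 'I_n -> A) (z : 'rV[R[i]]_n) : set (points A) :=
  affine_map a @^-1` [set z].

(* A finite flat morphism of degree 2 whose branch locus (the set of points of
   the base over which the two points of the fibre come together) is [D]; it is
   étale over the complement of [D], where the fibres, of length 2, have two
   distinct points. *)
Definition double_covering_branched_along
    (a : 'I_n -> A) (D : set 'rV[R[i]]_n) : Prop :=
  [/\ finite_flat_of_degree 2 a,
      forall z, ~ D z -> (fiber a z #= `I_2)%card
    & forall z, D z -> (fiber a z #= `I_1)%card].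

End AffineVariety.

Section CharacterVariety.
Variable R : realType.

(* The GIT quotient SL(2,C)^3 // PSL(2,C). *)
Definition V3 := points (inv_ring R).

Fact class_linear (rho : rep R) :
  scalar (fun f : inv_ring R => f rho).
Proof. by []. Qed.

Fact class_monoid_morphism (rho : rep R) :
  monoid_morphism (fun f : inv_ring R => f rho).
Proof. by []. Qed.

Definition class_fun (rho : rep R) (f : inv_ring R) : R[i] := f rho.

HB.instance Definition _ (rho : rep R) :=
  GRing.isLinear.Build R[i] (inv_ring R) R[i] *%R (class_fun rho)
    (class_linear rho).
HB.instance Definition _ (rho : rep R) :=
  GRing.isMonoidMorphism.Build (inv_ring R) R[i] (class_fun rho)
    (class_monoid_morphism rho).

(* The point [rho] of V_3: evaluation of invariant functions at rho. *)
Definition rep_class (rho : rep R) : V3 := class_fun rho.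

Definition word_mx (rho : rep R) (w : seq 'I_3) : 'M[R[i]]_2 :=
  \prod_(i <- w) SL2_mx (rho i).

Definition word_trace (w : seq 'I_3) (rho : rep R) : R[i] :=
  \tr (word_mx rho w).

Lemma word_mx_conj (g : SL2 R) (rho : rep R) (w : seq 'I_3) :
  word_mx (conj_rep g rho) w = g *m word_mx rho w *m invmx g.
Proof.
have gu : SL2_mx g \in unitmx by rewrite unitmxE det_SL2 unitr1.
rewrite /word_mx; elim: w => [|i w IHw].
  by rewrite !big_nil mulmx1 mulmxV.
rewrite !big_cons IHw /= -!mulmxE !mulmxA.
by rewrite -[X in X *m _ *m _ = _]mulmxA mulVmx // mulmx1.
Qed.

Lemma word_mx_polynomial (w : seq 'I_3) (a b : 'I_2) :
  regular (fun rho => word_mx rho w a b).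
Proof.
elim: w a b => [|i w IHw] a b.
  exists ((a == b)%:R) => rho; rewrite /word_mx big_nil mxE.
  by rewrite rmorph_nat.
have [Q hQ] := choice (fun c => IHw c b).
exists (\sum_c 'X_(enum_rank (i, (a, c))) * Q c) => rho.
rewrite /word_mx big_cons -mulmxE mxE rmorph_sum.
apply: eq_bigr => c _ /=.
by rewrite -/(word_mx rho w) hQ rmorphM /= mevalXU /entries enum_rankK.
Qed.

Fact word_trace_inv_regular (w : seq 'I_3) :
  word_trace w \in @inv_regular R.
Proof.
apply/inv_regularP; split=> [|g rho].
  have [Q hQ] := choice (fun a => word_mx_polynomial w a a).
  exists (\sum_a Q a) => rho; rewrite rmorph_sum /word_trace /mxtrace.
  by apply: eq_bigr => a _; exact: hQ.
have gu : SL2_mx g \in unitmx by rewrite unitmxE det_SL2 unitr1.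
by rewrite /word_trace word_mx_conj mxtrace_mulC mulmxA mulVmx // mul1mx.
Qed.

Definition trace_inv (w : seq 'I_3) : inv_ring R :=
  InvRing (word_trace_inv_regular w).

(* t_1, t_2, t_3, t_12, t_23, t_13, in this order. *)
Definition trace_words : 6.-tuple (seq 'I_3) :=
  [tuple [:: 0]; [:: 1]; [:: 2]; [:: 0; 1]; [:: 1; 2]; [:: 0; 2]].

Definition trace_coord (k : 'I_6) : inv_ring R :=
  trace_inv (tnth trace_words k).

Definition trace_map : V3 -> 'rV[R[i]]_6 := affine_map trace_coord.

Lemma trace_map_class (rho : rep R) :
  let X i : 'M[R[i]]_2 := rho i in
  let z := trace_map (rep_class rho) 0 in
  [/\ z 0 = \tr (X 0), z 1 = \tr (X 1) & z 2 = \tr (X 2)] /\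
  [/\ z 3 = \tr (X 0 *m X 1), z 4 = \tr (X 1 *m X 2)
    & z 5 = \tr (X 0 *m X 2)].
Proof.
have E k : trace_map (rep_class rho) 0 k = word_trace (tnth trace_words k) rho.
  by rewrite mxE.
by split; split; rewrite E /word_trace /word_mx !(tnth_nth [::]) /=
  !big_cons big_nil mulr1.
Qed.

Definition discriminant_locus : set 'rV[R[i]]_6 :=
  [set z | let t1 := z 0 0 in let t2 := z 0 1 in let t3 := z 0 2 in
           let t12 := z 0 3 in let t23 := z 0 4 in let t13 := z 0 5 in
    (t12 * t3 + t13 * t2 + t23 * t1 - t1 * t2 * t3) ^+ 2 =
    4 * ((t1 ^+ 2 + t2 ^+ 2 + t3 ^+ 2) + (t12 ^+ 2 + t23 ^+ 2 + t13 ^+ 2)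
         - (t1 * t2 * t12 + t2 * t3 * t23 + t3 * t1 * t13)
         + t12 * t23 * t13 - 4)].

End CharacterVariety.

(* Main.v *)
Require Import Defs.
From mathcomp Require Import all_boot all_order all_algebra.
From mathcomp Require Import complex mpoly.
From mathcomp Require Import boolp classical_sets functions cardinality reals.
From HB Require Import structures.
From mathcomp Require Import ring.

Set Implicit Arguments.
Unset Strict Implicit.
Unset Printing Implicit Defensive.

Import Order.TTheory GRing.Theory Num.Theory.

Local Open Scope ring_scope.

(** Let t be the six coordinates and y = tr (X1 X2 X3), and let S(t) and P(t) be
    the sum and the product of y and tr (X1 X3 X2), which are polynomials in t
    ([trace_reverse], [fricke_product]). Then y^2 = S(t) y - P(t), and
    everything follows once the ring of invariants is known to be the free
    C[t]-module with basis 1, y: it is then C[t][Y] / (Y^2 - S(t) Y + P(t)), so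
    that a point over z is the same thing as a root of the quadratic polynomial
    at z ([point_over], [point_eq_over]). A root exists for each z, there are
    two when S(z)^2 <> 4 P(z), and one when S(z)^2 = 4 P(z), which is the
    equation of the discriminant hypersurface.

    That 1 and y generate ([inv_regular_coord_span]) is the first fundamental
    theorem of invariant theory for triples of matrices, combined with the
    trace identities of Fricke. Let f be an invariant function and G a generic
    matrix of order two. As f (G^-1 X G) = f (X), clearing denominators gives
    f det(G)^N as a polynomial in det(G) and in the entries of the matrices
    adj(G) X_i G. The algebra generated by such entries, for all matrices W in
    place of X_i that are spanned by words, and by the traces of these W, is
    stable under Cayley's operator Omega = det(d/dG) ([concomitant_Omega]).
    Applying Omega N times turns det(G)^N into a nonzero integer by Cayley's
    identity ([Omega_gdetX]), and at G = 0 the other side becomes a polynomial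
    in traces of words. Finally the Cayley-Hamilton theorem and its polarization
    rewrite all words in terms of the products, in this order, of distinct X_i
    ([word_spanM]), so that only t and y are needed ([word_span_trace]).

    That 1 and y are independent ([coord_independent]) comes from transposing
    the three matrices, which fixes t and exchanges y with S(t) - y. If
    p(t) + q(t) y = 0 on all triples, then q(t) (2 y - S(t)) = 0, hence q
    vanishes at the values of t with distinct roots. Since t takes all values
    outside a hypersurface ([generic_triple]), q = 0 and then p = 0. *)

(** * Two by two matrices *)

Section TwoByTwo.
Variable K : comNzRingType.
Implicit Types A B C : 'M[K]_2.

Lemma big_ord2 (V : nmodType) (F : 'I_2 -> V) : \sum_i F i = F 0 + F 1.
Proof.
by rewrite !big_ord_recl big_ord0 addr0; congr (F _ + F _); apply: val_inj.
Qed.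

Lemma mulmx2E A B i j : (A *m B) i j = A i 0 * B 0 j + A i 1 * B 1 j.
Proof. by rewrite mxE big_ord2. Qed.

Lemma mxtrace2 A : \tr A = A 0 0 + A 1 1.
Proof. exact: big_ord2. Qed.

Lemma det2 A : \det A = A 0 0 * A 1 1 - A 0 1 * A 1 0.
Proof.
rewrite (expand_det_row _ 0) big_ord2 /cofactor !det_mx11 !mxE /=.
rewrite expr0 expr1 mul1r mulN1r mulrN.
by congr (A 0 0 * A _ _ - A 0 1 * A _ _); apply: val_inj.
Qed.

Lemma ord2P (i : 'I_2) : i = 0 \/ i = 1.
Proof.
by case: i => [[|[|//]] ?]; [left | right]; apply: val_inj.
Qed.

Lemma matrix2P A B :
  A 0 0 = B 0 0 -> A 0 1 = B 0 1 -> A 1 0 = B 1 0 -> A 1 1 = B 1 1 -> A = B.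
Proof.
by move=> *; apply/matrixP=> i j; case: (ord2P i) => ->; case: (ord2P j) => ->.
Qed.

Lemma cayley_hamilton2 A : \det A = 1 -> A *m A = \tr A *: A - 1%:M.
Proof.
move=> dA; have -> : 1%:M = (\det A)%:M by rewrite dA.
rewrite det2 mxtrace2.
by apply: matrix2P; rewrite !mxE !big_ord2 /= ?mulr1n ?mulr0n; ring.
Qed.

(** Polarizing the Cayley-Hamilton theorem allows B to move past A at the cost
    of shorter words. *)
Lemma fricke_commutation A B :
  B *m A = - (A *m B) + \tr A *: B + \tr B *: A
           + (\tr (A *m B) - \tr A * \tr B)%:M.
Proof.
rewrite !mxtrace2 !mulmx2E.
by apply: matrix2P; rewrite !mxE !big_ord2 /= ?mulr1n ?mulr0n; ring.
Qed.

(** The second factor on the left is tr (A C B), so the traces of the two cyclic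
    words in A, B, C are the roots of a quadratic polynomial. *)
Lemma fricke_product A B C : \det A = 1 -> \det B = 1 -> \det C = 1 ->
  \tr (A *m B *m C) *
    (\tr (A *m B) * \tr C + \tr (A *m C) * \tr B + \tr (B *m C) * \tr A
     - \tr A * \tr B * \tr C - \tr (A *m B *m C)) =
  (\tr A ^+ 2 + \tr B ^+ 2 + \tr C ^+ 2)
  + (\tr (A *m B) ^+ 2 + \tr (B *m C) ^+ 2 + \tr (A *m C) ^+ 2)
  - (\tr A * \tr B * \tr (A *m B) + \tr B * \tr C * \tr (B *m C)
     + \tr C * \tr A * \tr (A *m C))
  + \tr (A *m B) * \tr (B *m C) * \tr (A *m C) - 4.
Proof.
move=> dA dB dC.
(* Homogenizing with the determinants makes this a polynomial identity. *)
transitivity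
  ((\tr A ^+ 2 * \det B * \det C + \tr B ^+ 2 * \det A * \det C
    + \tr C ^+ 2 * \det A * \det B)
  + (\tr (A *m B) ^+ 2 * \det C + \tr (B *m C) ^+ 2 * \det A
     + \tr (A *m C) ^+ 2 * \det B)
  - (\tr A * \tr B * \tr (A *m B) * \det C + \tr B * \tr C * \tr (B *m C) * \det A
     + \tr C * \tr A * \tr (A *m C) * \det B)
  + \tr (A *m B) * \tr (B *m C) * \tr (A *m C) - 4 * \det A * \det B * \det C).
  rewrite !mxtrace2 !det2 !mulmx2E; ring.
rewrite dA dB dC; ring.
Qed.

End TwoByTwo.

(** * The algebra of words in three matrices *)

Section WordAlgebra.
Variables (K : comNzRingType) (S : subringClosed K).
Implicit Types (A B U V W : 'M[K]_2) (N : 'M[K]_2 -> Prop).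

Definition Smodule N :=
  (forall U V, N U -> N V -> N (U + V)) /\
  (forall a U, a \in S -> N U -> N (a *: U)).

Definition scalars W : Prop := exists2 a, a \in S & W = a%:M.

(** Only words with a single A, in last position, are adjoined: in the cases of
    interest the Cayley-Hamilton theorem reduces all others to these. *)
Definition adjoin N A W : Prop :=
  exists U V, [/\ N U, N V & W = U + V *m A].

Lemma SmoduleN N U : Smodule N -> N U -> N (- U).
Proof. by move=> [_ NZ] NU; rewrite -scaleN1r; apply: NZ; rewrite ?rpredN1. Qed.

Lemma Smodule_scalars : Smodule scalars.
Proof.
split=> [_ _ [a aS ->] [b bS ->]|c _ cS [a aS ->]].
  by exists (a + b); rewrite ?rpredD // raddfD.
by exists (c * a); rewrite ?rpredM // -scale_scalar_mx.
Qed.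

Lemma Smodule_adjoin N A : Smodule N -> Smodule (adjoin N A).
Proof.
move=> [ND NZ]; split.
  move=> _ _ [U [V [NU NV ->]]] [U' [V' [NU' NV' ->]]].
  by exists (U + U'), (V + V'); split; [exact: ND|exact: ND|
     rewrite mulmxDl addrACA].
move=> a _ aS [U [V [NU NV ->]]].
by exists (a *: U), (a *: V); split; [exact: NZ|exact: NZ|
     rewrite scalerDr scalemxAl].
Qed.

Lemma adjoin_sub N A U : Smodule N -> N U -> adjoin N A U.
Proof.
move=> [_ NZ] NU; exists U, (0 *: U); split=> //; first exact/NZ/NU/rpred0.
by rewrite scale0r mul0mx addr0.
Qed.

Lemma adjoin_gen N A : Smodule N -> N 1%:M -> adjoin N A A.
Proof.
move=> [_ NZ] N1; exists (0 *: 1%:M), 1%:M; split=> //; first exact/NZ/N1/rpred0.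
by rewrite scale0r mul1mx add0r.
Qed.

(** The square of A is eliminated by A^2 = (tr A) A - 1. *)
Lemma adjoin_mulr N A W : Smodule N -> \det A = 1 -> \tr A \in S ->
  adjoin N A W -> adjoin N A (W *m A).
Proof.
move=> Nmod dA tA [U [V [NU NV ->]]]; have [ND NZ] := Nmod.
exists (- V), (U + \tr A *: V); split.
- exact: SmoduleN.
- by apply: ND => //; apply: NZ.
rewrite mulmxDl -mulmxA cayley_hamilton2 // mulmxBr mulmx1 -scalemxAr.
by rewrite mulmxDl -scalemxAl addrA addrC.
Qed.

(** The factor B is moved to the left of A by [fricke_commutation], and N
    absorbs it there. *)
Lemma adjoin_mulr_other N A B W : Smodule N ->
    \tr A \in S -> \tr B \in S -> \tr (B *m A) \in S ->
    (forall U, N U -> N (U *m B)) ->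
  adjoin N A W -> adjoin N A (W *m B).
Proof.
move=> Nmod tA tB tBA NB [U [V [NU NV ->]]]; have [ND NZ] := Nmod.
pose c := \tr (B *m A) - \tr B * \tr A.
have cS : c \in S by rewrite rpredB ?rpredM.
exists (U *m B + \tr A *: (V *m B) + c *: V), (\tr B *: V - V *m B); split.
- by apply: (ND); [apply: (ND); [exact: NB|exact/NZ/NB]|exact: NZ].
- by apply: (ND); [exact: NZ|exact/(SmoduleN Nmod)/NB].
rewrite mulmxDl -mulmxA (fricke_commutation B A) -/c.
rewrite !mulmxDr mulmxN mulmxA mulmxDl mulNmx -!scalemxAr -!scalemxAl.
rewrite mul_mx_scalar.
move: (U *m B) (V *m B) (V *m B *m A) => P Q T.
by apply/matrixP => i j; rewrite !mxE; ring.
Qed.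

Section ThreeMatrices.
Variables X Y Z : 'M[K]_2.
Hypotheses (detX : \det X = 1) (detY : \det Y = 1) (detZ : \det Z = 1).
Hypotheses (trX : \tr X \in S) (trY : \tr Y \in S) (trZ : \tr Z \in S).
Hypotheses (trXY : \tr (X *m Y) \in S) (trYZ : \tr (Y *m Z) \in S).
Hypotheses (trXZ : \tr (X *m Z) \in S) (trXYZ : \tr (X *m Y *m Z) \in S).

Let N1 := adjoin scalars X.
Let N2 := adjoin N1 Y.
(** The S-module spanned by the eight words 1, X, Y, X Y, Z, X Z, Y Z, X Y Z. *)
Definition word_span := adjoin N2 Z.

Let N1mod : Smodule N1. Proof. exact/Smodule_adjoin/Smodule_scalars. Qed.
Let N2mod : Smodule N2. Proof. exact/Smodule_adjoin/N1mod. Qed.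

Lemma Smodule_word_span : Smodule word_span.
Proof. exact/Smodule_adjoin/N2mod. Qed.

Lemma word_span_scalar a : a \in S -> word_span a%:M.
Proof.
move=> aS; do 2![apply: adjoin_sub => //]; apply: adjoin_sub; last by exists a.
exact: Smodule_scalars.
Qed.

Lemma word_span_gens : [/\ word_span X, word_span Y & word_span Z].
Proof.
have one0 : scalars 1%:M by exists 1; rewrite ?rpred1.
have one1 : N1 1%:M by apply: adjoin_sub => //; apply: Smodule_scalars.
have one2 : N2 1%:M by apply: adjoin_sub.
split; last exact: adjoin_gen.
  do 2![apply: adjoin_sub => //]; apply: adjoin_gen => //.
  exact: Smodule_scalars.
by apply: adjoin_sub => //; apply: adjoin_gen.
Qed.

Lemma word_span_mulX W : word_span W -> word_span (W *m X).
Proof.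
apply: adjoin_mulr_other => // U; apply: adjoin_mulr_other => // V.
exact/adjoin_mulr/trX/detX/Smodule_scalars.
Qed.

Lemma word_span_mulY W : word_span W -> word_span (W *m Y).
Proof. by apply: adjoin_mulr_other => // U; apply: adjoin_mulr. Qed.

Lemma word_span_mulZ W : word_span W -> word_span (W *m Z).
Proof. exact: adjoin_mulr. Qed.

Lemma word_spanM U V : word_span U -> word_span V -> word_span (U *m V).
Proof.
have [spanD spanZ] := Smodule_word_span.
pose acts W := forall U, word_span U -> word_span (U *m W).
have acts_adjoin N A : (forall W, N W -> acts W) -> acts A ->
    forall W, adjoin N A W -> acts W.
  move=> NP AP _ [U1 [V1 [NU NV ->]]] U2 U2s.
  rewrite mulmxDr mulmxA; apply: (spanD); first exact: NP.
  by apply: AP; apply: NP.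
suff: forall W, word_span W -> acts W by move=> + Us Vs; apply.
apply: (acts_adjoin) word_span_mulZ; apply: (acts_adjoin) word_span_mulY.
apply: (acts_adjoin) word_span_mulX => _ [a aS ->] W Ws.
by rewrite mul_mx_scalar; apply: (spanZ).
Qed.

(** The traces of the eight spanning words are 2 and the seven traces that S is
    supposed to contain. *)
Lemma word_span_trace W : word_span W -> \tr W \in S.
Proof.
have N1P W1 : N1 W1 -> exists2 a, a \in S & exists2 b, b \in S & W1 = a%:M + b *: X.
  move=> [_ [_ [[a aS ->] [b bS ->] ->]]].
  by exists a => //; exists b => //; rewrite mul_scalar_mx.
have N1tr W1 B : \tr B \in S -> \tr (X *m B) \in S -> N1 W1 -> \tr (W1 *m B) \in S.
  move=> tB tXB /N1P[a aS [b bS ->]].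
  rewrite mulmxDl mul_scalar_mx -scalemxAl mxtraceD !mxtraceZ.
  by rewrite rpredD ?rpredM.
have N2tr W2 B : \tr B \in S -> \tr (X *m B) \in S -> \tr (Y *m B) \in S ->
    \tr (X *m Y *m B) \in S -> N2 W2 -> \tr (W2 *m B) \in S.
  move=> tB tXB tYB tXYB [U [V [NU NV ->]]].
  rewrite mulmxDl mxtraceD rpredD //; first exact: N1tr.
  by rewrite -mulmxA N1tr // mulmxA.
have tr1 : \tr (1%:M : 'M[K]_2) \in S by rewrite mxtrace1 rpred_nat.
move=> [U [V [NU NV ->]]]; rewrite mxtraceD rpredD //; last exact: N2tr.
by rewrite -(mulmx1 U) N2tr ?mulmx1.
Qed.

End ThreeMatrices.
End WordAlgebra.

(** * Cayley's Omega process *)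

Section OmegaProcess.
Variable K : comNzRingType.
(* The variable in row i and column a of the generic matrix G is the one of
   index gvar i a. *)
Variables (n : nat) (gvar : 'I_2 -> 'I_2 -> 'I_n).
Hypothesis gvar_eq : forall i a j b, (gvar i a == gvar j b) = (i == j) && (a == b).
Local Notation gpoly := {mpoly K[n]}.
Implicit Types (p q r : gpoly) (W V : 'M[K]_2) (a b c d : 'I_2).

Definition adj2 W : 'M[K]_2 := (\tr W)%:M - W.

Definition gcol (i a : 'I_2) : gpoly := 'X_(gvar i a).

(** The effect of Omega on the product of a coordinate of column a of G by a
    coordinate of column b: it contracts distinct columns with opposite signs,
    and a column with itself to zero. *)
Definition eps a b : gpoly :=
  (a == 0)%:R * (b == 1)%:R - (a == 1)%:R * (b == 0)%:R.

(** The determinant of the two columns g_a and W g_b, where g_a and g_b are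
    columns of G. *)
Definition gform W a b : gpoly :=
  gcol 0 a * ((W 1 0)%:MP * gcol 0 b + (W 1 1)%:MP * gcol 1 b)
  - gcol 1 a * ((W 0 0)%:MP * gcol 0 b + (W 0 1)%:MP * gcol 1 b).

(** The determinant of the matrix of partial derivatives in the entries of G. *)
Definition Omega p : gpoly :=
  p^`M(gvar 0 0)^`M(gvar 1 1) - p^`M(gvar 1 0)^`M(gvar 0 1).

(** The terms of Omega (p * q) in which the two derivatives fall on different
    factors; this is a derivation in each argument. *)
Definition Omega_cross p q : gpoly :=
  p^`M(gvar 0 0) * q^`M(gvar 1 1) + p^`M(gvar 1 1) * q^`M(gvar 0 0)
  - (p^`M(gvar 1 0) * q^`M(gvar 0 1) + p^`M(gvar 0 1) * q^`M(gvar 1 0)).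

Lemma OmegaD p q : Omega (p + q) = Omega p + Omega q.
Proof. by rewrite /Omega !mderivD opprD addrACA. Qed.

Lemma OmegaCM (k : K) p : Omega (k%:MP * p) = k%:MP * Omega p.
Proof. by rewrite /Omega !mderiv_mulC mulrBr. Qed.

Lemma OmegaM p q : Omega (p * q) = Omega p * q + p * Omega q + Omega_cross p q.
Proof. by rewrite /Omega /Omega_cross !(mderivM, mderivD); ring. Qed.

Lemma Omega_crossC p q : Omega_cross p q = Omega_cross q p.
Proof. by rewrite /Omega_cross; ring. Qed.

Lemma Omega_crossDr p q r :
  Omega_cross p (q + r) = Omega_cross p q + Omega_cross p r.
Proof. by rewrite /Omega_cross !mderivD; ring. Qed.

Lemma Omega_crossMr p q r :
  Omega_cross p (q * r) = Omega_cross p q * r + q * Omega_cross p r.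
Proof. by rewrite /Omega_cross !mderivM; ring. Qed.

Lemma Omega_crossC0 p (c : K) : Omega_cross p c%:MP = 0.
Proof. by rewrite /Omega_cross !mderivC !mulr0 !addr0 subr0. Qed.

Lemma OmegaC (c : K) : Omega c%:MP = 0.
Proof. by rewrite /Omega !mderivC ?mderiv0 subr0. Qed.

Lemma mderiv_gcol i a j b :
  (gcol i a)^`M(gvar j b) = ((i == j) && (a == b))%:R.
Proof.
rewrite /gcol mderivX mnm1E gvar_eq; case: eqP => [->|_] /=; last by rewrite scale0r.
case: eqP => [->|_] /=; last by rewrite scale0r.
rewrite scale1r; suff -> : (U_(gvar j b) - U_(gvar j b) = 0)%MM by rewrite mpolyX0.
by apply/mnmP => k; rewrite mnmBE subnn mnm0E.
Qed.

Lemma mderiv_nat m i : (m%:R : gpoly)^`M(i) = 0.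
Proof. by rewrite -mpolyC_nat mderivC. Qed.

(** The gradients of [gform W a b] with respect to its left and right columns. *)
Definition gradl W b (j : 'I_2) : gpoly :=
  (-1) ^+ j * ((W (1 - j) 0)%:MP * gcol 0 b + (W (1 - j) 1)%:MP * gcol 1 b).

Definition gradr W a (j : 'I_2) : gpoly :=
  gcol 0 a * (W 1 j)%:MP - gcol 1 a * (W 0 j)%:MP.

Lemma mderiv_gform W a b j c : (gform W a b)^`M(gvar j c) =
  (a == c)%:R * gradl W b j + (b == c)%:R * gradr W a j.
Proof.
rewrite /gradl /gradr /gform !(mderivB, mderivM, mderivD, mderivC, mderiv_gcol).
by case: (ord2P j) => -> /=; rewrite ?subr0 ?subrr ?expr0 ?expr1; ring.
Qed.

Definition wedge (x y : 'I_2 -> gpoly) := x 0 * y 1 - x 1 * y 0.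

(** Gradients are images of columns under W or its adjugate, up to a rotation by
    a right angle. The adjugate being the adjoint for the determinant form, as in
    det (W x, V y) = det (x, adj(W) V y), the wedge of two gradients is again a
    [gform]. *)
Lemma wedge_ll W V b d : wedge (gradl W b) (gradl V d) = gform (adj2 W *m V) b d.
Proof.
rewrite /wedge /gradl /gform !mulmx2E !mxE !mxtrace2 /= ?mulr1n ?mulr0n.
rewrite ?subr0 ?subrr ?expr0 ?expr1.
by rewrite !(rmorphD, rmorphN, rmorphM, rmorph0) /=; ring.
Qed.

Lemma wedge_lr W V b c :
  wedge (gradl W b) (gradr V c) = - gform (adj2 W *m adj2 V) b c.
Proof.
rewrite /wedge /gradl /gradr /gform !mulmx2E !mxE !mxtrace2 /= ?mulr1n ?mulr0n.
rewrite ?subr0 ?subrr ?expr0 ?expr1.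
by rewrite !(rmorphD, rmorphN, rmorphM, rmorph0) /=; ring.
Qed.

Lemma wedge_rl W V a d : wedge (gradr W a) (gradl V d) = - gform (W *m V) a d.
Proof.
rewrite /wedge /gradl /gradr /gform !mulmx2E /=.
rewrite ?subr0 ?subrr ?expr0 ?expr1.
by rewrite !(rmorphD, rmorphN, rmorphM, rmorph0) /=; ring.
Qed.

Lemma wedge_rr W V a c : wedge (gradr W a) (gradr V c) = gform (W *m adj2 V) a c.
Proof.
rewrite /wedge /gradl /gradr /gform !mulmx2E !mxE !mxtrace2 /= ?mulr1n ?mulr0n.
by rewrite !(rmorphD, rmorphN, rmorphM, rmorph0) /=; ring.
Qed.

(** Contracting two forms glues them along one column of each, and the matrix of
    the resulting form is a product. This is why the algebra of concomitants is
    stable under Omega. *)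
Lemma Omega_cross_gform W V a b c d :
  Omega_cross (gform W a b) (gform V c d) =
  eps a c * gform (adj2 W *m V) b d - eps a d * gform (adj2 W *m adj2 V) b c
  - eps b c * gform (W *m V) a d + eps b d * gform (W *m adj2 V) a c.
Proof.
rewrite /Omega_cross !mderiv_gform -(wedge_ll W V b d) -(wedge_rr W V a c).
rewrite -[gform (adj2 W *m adj2 V) b c]opprK -wedge_lr.
rewrite -[gform (W *m V) a d]opprK -wedge_rl /wedge /eps.
move: (gradl W b) (gradl V d) (gradr W a) (gradr V c) => L L' R R'.
move: (L 0) (L 1) (L' 0) (L' 1) => L0 L1 M0 M1.
move: (R 0) (R 1) (R' 0) (R' 1) => R0 R1 N0 N1.
move: (a == 0)%:R (a == 1)%:R (b == 0)%:R (b == 1)%:R => a0 a1 b0 b1.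
move: (c == 0)%:R (c == 1)%:R (d == 0)%:R (d == 1)%:R => c0 c1 d0 d1.
ring.
Qed.

Lemma Omega_gform W a b : Omega (gform W a b) = eps a b * (\tr W)%:MP.
Proof.
rewrite mxtrace2 raddfD /= /Omega !mderiv_gform /gradl /gradr /eps.
rewrite !(mderivB, mderivM, mderivD, mderivC, mderiv_gcol, mderiv_nat) /=.
rewrite ?subr0 ?subrr ?expr0 ?expr1 ?mderivN ?(mderiv_nat 1).
move: (a == 0)%:R (a == 1)%:R (b == 0)%:R (b == 1)%:R => a0 a1 b0 b1.
ring.
Qed.

Definition gdet : gpoly := gform 1%:M 0 1.

Lemma gdetE : gdet = gcol 0 0 * gcol 1 1 - gcol 1 0 * gcol 0 1.
Proof. by rewrite /gdet /gform !mxE /= mulr1n mulr0n mpolyC0 mpolyC1; ring. Qed.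

Lemma Omega_gdet : Omega gdet = 2.
Proof.
rewrite /gdet Omega_gform // mxtrace1 mpolyC_nat /eps !eqxx /=.
by rewrite mulr1 mul0r subr0 mul1r.
Qed.

Lemma Omega_cross_gdet : Omega_cross gdet gdet = 2 * gdet.
Proof.
rewrite gdetE /Omega_cross !mderivB !mderivM !mderiv_gcol //=; ring.
Qed.

Lemma Omega_cross_gdetX m : Omega_cross gdet (gdet ^+ m) = (2 * m)%:R * gdet ^+ m.
Proof.
elim: m => [|m IHm].
  by rewrite expr0 muln0 mul0r -(mpolyC1 n K) Omega_crossC0.
rewrite exprS Omega_crossMr IHm Omega_cross_gdet mulnS natrD; ring.
Qed.

(** Cayley's identity for matrices of order two. *)
Lemma Omega_gdetX m : Omega (gdet ^+ m.+1) = (m.+1 * m.+2)%:R * gdet ^+ m.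
Proof.
elim: m => [|m IHm]; first by rewrite expr1 Omega_gdet expr0 mulr1.
rewrite exprS OmegaM IHm Omega_gdet Omega_cross_gdetX exprS.
by rewrite !natrM; ring.
Qed.

Lemma iter_OmegaCM m (k : K) p : iter m Omega (k%:MP * p) = k%:MP * iter m Omega p.
Proof. by elim: m => [//|m IHm] /=; rewrite IHm OmegaCM. Qed.

Lemma iter_OmegaX m : exists2 N, (0 < N)%N & iter m Omega (gdet ^+ m) = N%:R.
Proof.
elim: m => [|m [N N0 IHm]]; first by exists 1%N.
exists (m.+1 * m.+2 * N)%N; first by rewrite !muln_gt0.
by rewrite iterSr Omega_gdetX -mpolyC_nat iter_OmegaCM IHm mpolyC_nat -natrM.
Qed.

Section Concomitants.
Variables (S : subringClosed K) (T : 'M[K]_2 -> Prop).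
Hypothesis TM : forall U V, T U -> T V -> T (U *m V).
Hypothesis Tadj : forall U, T U -> T (adj2 U).
Hypothesis Ttr : forall U, T U -> \tr U \in S.

(** The matrices W are confined to a class T, which will be the span of words. *)
Inductive concomitant : gpoly -> Prop :=
| concomitantC k : k \in S -> concomitant k%:MP
| concomitant_form W a b : T W -> concomitant (gform W a b)
| concomitantD p q : concomitant p -> concomitant q -> concomitant (p + q)
| concomitantM p q : concomitant p -> concomitant q -> concomitant (p * q).

Lemma concomitantN p : concomitant p -> concomitant (- p).
Proof.
move=> cp; rewrite -mulN1r -mpolyC1 -mpolyCN.
by apply: concomitantM => //; apply: concomitantC; rewrite rpredN rpred1.
Qed.

Lemma concomitant_eps a b : concomitant (eps a b).
Proof.
rewrite /eps -!natrM -!mpolyC_nat; apply: concomitantD; last apply: concomitantN.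
  by apply/concomitantC/rpred_nat.
by apply/concomitantC/rpred_nat.
Qed.

(** Both arguments are reduced to generators by the derivation property. *)
Lemma concomitant_cross p q :
  concomitant p -> concomitant q -> concomitant (Omega_cross p q).
Proof.
have c0 : concomitant 0 by rewrite -mpolyC0; apply/concomitantC/rpred0.
elim=> [k kS|W a b WT|p1 p2 c1 IH1 c2 IH2|p1 p2 c1 IH1 c2 IH2] cq.
- by rewrite Omega_crossC Omega_crossC0.
- elim: cq => [k kS|V c d VT|q1 q2 _ IH1 _ IH2|q1 q2 c1 IH1 c2 IH2].
  + by rewrite Omega_crossC0.
  + rewrite Omega_cross_gform //.
    have cM x y U e f : T U -> concomitant (eps x y * gform U e f).
      move=> UT; apply: concomitantM; first exact: concomitant_eps.
      exact: concomitant_form.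
    by do ![apply: concomitantD | apply: concomitantN | apply: cM | apply: TM
           | apply: Tadj].
  + by rewrite Omega_crossDr; apply: concomitantD.
  + by rewrite Omega_crossMr; apply: concomitantD; apply: concomitantM.
- by rewrite Omega_crossC Omega_crossDr; apply: concomitantD;
    rewrite Omega_crossC; [exact: IH1|exact: IH2].
- rewrite Omega_crossC Omega_crossMr; apply: concomitantD; apply: concomitantM => //;
    rewrite Omega_crossC; [exact: IH1|exact: IH2].
Qed.

Lemma concomitant_Omega p : concomitant p -> concomitant (Omega p).
Proof.
elim=> [k kS|W a b WT|p1 p2 c1 IH1 c2 IH2|p1 p2 c1 IH1 c2 IH2].
- by rewrite OmegaC -mpolyC0; apply/concomitantC/rpred0.
- rewrite Omega_gform //; apply: concomitantM; first exact: concomitant_eps.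
  exact/concomitantC/Ttr.
- by rewrite OmegaD; apply: concomitantD.
- rewrite OmegaM; apply: concomitantD; last exact: concomitant_cross.
  by apply: concomitantD; apply: concomitantM.
Qed.

(** Every [gform] vanishes at G = 0, so only coefficients in S survive there. *)
Lemma concomitant_const k : concomitant k%:MP -> k \in S.
Proof.
suff H p : concomitant p -> p.@[fun=> 0] \in S by move=> /H; rewrite mevalC.
elim=> {p} [l lS|W a b WT|p q _ pS _ qS|p q _ pS _ qS].
- by rewrite mevalC.
- by rewrite /gform !(mevalB, mevalM, mevalXU) !mul0r subr0 rpred0.
- by rewrite mevalD rpredD.
- by rewrite mevalM rpredM.
Qed.

(** By Cayley's identity, m applications of Omega leave a nonzero integer
    multiple of k; on the other hand the result is a constant concomitant. *)
Lemma concomitant_invariant k m : concomitant (k%:MP * gdet ^+ m) ->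
  exists2 N, (0 < N)%N & N%:R * k \in S.
Proof.
move=> ck; have [N N0 NE] := iter_OmegaX m; exists N => //.
apply: concomitant_const; rewrite mpolyCM mpolyC_nat -NE mulrC.
rewrite -iter_OmegaCM; elim: {1}m => [//|i IHi]; exact: concomitant_Omega.
Qed.

End Concomitants.
End OmegaProcess.

(** * Polynomials vanishing on a dense set *)

Section Vanishing.

Lemma digits_inj n d (a b : 'I_n -> nat) :
    (forall i, a i < d)%N -> (forall i, b i < d)%N ->
  (\sum_i a i * d ^ i = \sum_i b i * d ^ i)%N -> a =1 b.
Proof.
elim: n a b => [|n IHn] a b ad bd; first by move=> _ [].
rewrite !big_ord_recl !expn0 !muln1.
have shift (c : 'I_n.+1 -> nat) : (\sum_(i < n) c (lift ord0 i) * d ^ lift ord0 i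
    = (\sum_(i < n) c (lift ord0 i) * d ^ i) * d)%N.
  by rewrite big_distrl; apply: eq_bigr => i _ /=; rewrite /bump /= expnS mulnCA mulnC.
rewrite !shift !(addnC _ (_ * d)%N) => E.
have d0 : (0 < d)%N by apply: leq_ltn_trans (ad ord0).
have E0 : a ord0 = b ord0.
  by have := congr1 (modn^~ d) E; rewrite /= !modnMDl !modn_small.
have E1 := congr1 (divn^~ d) E.
rewrite /= !divnMDl // !divn_small // !addn0 in E1.
move=> i; have [j ->|->] := unliftP ord0 i; last exact: E0.
by apply: (IHn (a \o lift ord0) (b \o lift ord0)) => // k /=.
Qed.

Variables (F : numFieldType) (n : nat).
Implicit Types p q : {mpoly F[n]}.

Lemma poly_vanishing_eq0 (q : {poly F}) : (forall x, q.[x] = 0) -> q = 0.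
Proof.
move=> q0; apply: (@roots_geq_poly_eq0 _ q [seq i%:R | i <- iota 0 (size q)]).
- by apply/allP => x _; apply/rootP.
- rewrite map_inj_uniq ?iota_uniq // => i j /eqP.
  by rewrite eqr_nat => /eqP.
- by rewrite size_map size_iota.
Qed.

(** Kronecker's substitution of x^(d^i) for the i-th variable is injective on
    polynomials with exponents below d, by uniqueness of the expansion in base
    d; this reduces the question to one variable. *)
Lemma mpoly_vanishing_eq0 p : (forall v, p.@[v] = 0) -> p = 0.
Proof.
move=> p0; pose d := msize p.
pose e (m : 'X_{1..n}) := (\sum_(i < n) m i * d ^ i)%N.
pose q : {poly F} := \sum_(m <- msupp p) p@_m *: 'X^(e m).
have q0 : q = 0.
  apply: poly_vanishing_eq0 => x; rewrite -(p0 (fun i => x ^+ (d ^ i))) mevalE.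
  rewrite horner_sum; apply: eq_bigr => m _; rewrite hornerZ hornerXn.
  by rewrite -prodrXr; congr (_ * _); apply: eq_bigr => i _; rewrite -exprM mulnC.
apply/mpolyP => m; rewrite mcoeff0; apply/eqP/negPn/negP; rewrite -mcoeff_msupp => mp.
have ltd m' i : m' \in msupp p -> (m' i < d)%N.
  move=> /msize_mdeg_lt; apply: leq_ltn_trans.
  by rewrite mdegE (bigD1 i) //= leq_addr.
have := congr1 (fun r : {poly F} => r`_(e m)) q0.
rewrite coef0 coef_sum (bigD1_seq m) ?msupp_uniq //= big_seq_cond big1.
  rewrite addr0 coefZ coefXn eqxx mulr1 => /eqP; apply/negP.
  by rewrite -mcoeff_msupp.
move=> m' /andP[m'p ne]; rewrite coefZ coefXn.
case: eqP => [E|_]; last by rewrite mulr0.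
case/eqP: ne; apply/mnmP => i; apply: digits_inj (esym E) i => k; exact: ltd.
Qed.

Lemma mpoly_dense_eq0 d p :
  d != 0 -> (forall v, d.@[v] != 0 -> p.@[v] = 0) -> p = 0.
Proof.
move=> d0 H; suff /eqP : d * p = 0 by rewrite mulf_eq0 (negPf d0) => /eqP.
apply: mpoly_vanishing_eq0 => v; rewrite mevalM.
by have [->|/H->] := eqVneq d.@[v] 0; rewrite ?mul0r ?mulr0.
Qed.

Lemma mpoly_dense_eq d p q :
  d != 0 -> (forall v, d.@[v] != 0 -> p.@[v] = q.@[v]) -> p = q.
Proof.
move=> d0 H; apply/eqP; rewrite -subr_eq0; apply/eqP/(mpoly_dense_eq0 d0) => v /H E.
by rewrite mevalB E subrr.
Qed.
End Vanishing.

(** * Specializing the generic matrix *)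

Lemma adj2_mul (F : comNzRingType) (A : 'M[F]_2) : adj2 A *m A = (\det A)%:M.
Proof.
rewrite det2; apply: matrix2P; rewrite mulmx2E !mxE mxtrace2 /= ?mulr1n ?mulr0n; ring.
Qed.

Section Evaluation.
Variables (K F : comNzRingType) (h : {rmorphism K -> F}).
Variables (n : nat) (gvar : 'I_2 -> 'I_2 -> 'I_n) (v : 'I_n -> F).
Implicit Types (p q : {mpoly K[n]}).

Definition eval_at : {mpoly K[n]} -> F := meval v \o map_mpoly h.

HB.instance Definition _ := GRing.RMorphism.on eval_at.

Definition gmat : 'M[F]_2 := \matrix_(i, a) v (gvar i a).

Lemma eval_atD p q : eval_at (p + q) = eval_at p + eval_at q.
Proof. exact: rmorphD. Qed.

Lemma eval_atB p q : eval_at (p - q) = eval_at p - eval_at q.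
Proof. exact: rmorphB. Qed.

Lemma eval_atM p q : eval_at (p * q) = eval_at p * eval_at q.
Proof. exact: rmorphM. Qed.

Lemma eval_atC (k : K) : eval_at k%:MP = h k.
Proof. by rewrite /eval_at /= map_mpolyC mevalC. Qed.

Lemma eval_at_gcol i a : eval_at (gcol K gvar i a) = gmat i a.
Proof. by rewrite /eval_at /gcol /= map_mpolyX mevalXU mxE. Qed.

Lemma eval_at_gdet : eval_at (gdet K gvar) = \det gmat.
Proof.
by rewrite gdetE eval_atB !eval_atM !eval_at_gcol det2 [gmat 1 0 * _]mulrC.
Qed.

(** The (a, b) entry of adj(G) W G. *)
Definition gconj (W : 'M[K]_2) (a b : 'I_2) : {mpoly K[n]} :=
  (-1) ^+ (1 - a) * gform gvar W (1 - a) b.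

Lemma eval_at_gconj (W : 'M[K]_2) a b :
  eval_at (gconj W a b) = (adj2 gmat *m map_mx h W *m gmat) a b.
Proof.
rewrite /gconj eval_atM (rmorph_sign eval_at) /gform.
rewrite eval_atB !eval_atM !eval_atD !eval_atM !eval_at_gcol !eval_atC.
move: gmat => G; rewrite !mulmx2E !mxE mxtrace2.
by case: (ord2P a) => ->;
  rewrite /= ?subr0 ?subrr ?expr0 ?expr1 ?mxE ?mulr1n ?mulr0n; ring.
Qed.

End Evaluation.

Lemma conj_scaled_inv (F : fieldType) n (s : F) (G X : 'M[F]_n) :
  s != 0 -> G \in unitmx ->
  (s *: invmx G) *m X *m invmx (s *: invmx G) = invmx G *m X *m G.
Proof.
move=> s0 Gu; have -> : invmx (s *: invmx G) = s^-1 *: G.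
  rewrite invmxZ ?invmxK // unitmxZ ?unitfE // unitmx_inv //.
by rewrite -!scalemxAl -scalemxAr scalerA mulfV // scale1r.
Qed.

(** * The span of 1 and t123 over the six coordinates *)

(** The sum and the product of tr (X1 X2 X3) and tr (X1 X3 X2) in terms of the
    six coordinates. They are defined over any ring so as to serve for numbers,
    for polynomials and for invariant functions. *)
Definition fricke_sum (C : comNzRingType) (t : 'I_6 -> C) : C :=
  t 3 * t 2 + t 5 * t 1 + t 4 * t 0 - t 0 * t 1 * t 2.

Definition fricke_prod (C : comNzRingType) (t : 'I_6 -> C) : C :=
  (t 0 ^+ 2 + t 1 ^+ 2 + t 2 ^+ 2) + (t 3 ^+ 2 + t 4 ^+ 2 + t 5 ^+ 2)
  - (t 0 * t 1 * t 3 + t 1 * t 2 * t 4 + t 2 * t 0 * t 5)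
  + t 3 * t 4 * t 5 - 4.

Lemma rmorph_fricke_sum (A B : comNzRingType) (h : {rmorphism A -> B}) t :
  h (fricke_sum t) = fricke_sum (h \o t).
Proof. by rewrite /fricke_sum !(rmorphB, rmorphD, rmorphM). Qed.

Lemma rmorph_fricke_prod (A B : comNzRingType) (h : {rmorphism A -> B}) t :
  h (fricke_prod t) = fricke_prod (h \o t).
Proof.
rewrite /fricke_prod rmorphB rmorph_nat !(rmorphB, rmorphD, rmorphM) /=.
by rewrite !expr2.
Qed.

Section CharacterRing.
Variable R : realType.
Local Notation C := R[i].
Local Notation K := (rep R -> C).
Implicit Types (rho : rep R) (f : K).

Definition gen_mx (i : 'I_3) : 'M[K]_2 := \matrix_(a, b) (fun rho => rho i a b).

(** Evaluation at rho under a name of its own, to carry a morphism structure. *)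
Definition at_rep rho f : C := f rho.

Fact at_rep_zmod rho : zmod_morphism (at_rep rho).
Proof. by []. Qed.
Fact at_rep_monoid rho : monoid_morphism (at_rep rho).
Proof. by []. Qed.
HB.instance Definition _ rho :=
  GRing.isZmodMorphism.Build K C (at_rep rho) (at_rep_zmod rho).
HB.instance Definition _ rho :=
  GRing.isMonoidMorphism.Build K C (at_rep rho) (at_rep_monoid rho).

Lemma map_gen_mx rho i : map_mx (at_rep rho) (gen_mx i) = rho i.
Proof. by apply/matrixP => a b; rewrite !mxE. Qed.

Lemma det_gen_mx i : \det (gen_mx i) = 1.
Proof.
apply/funext => rho; rewrite -[LHS]/(at_rep rho _) -det_map_mx map_gen_mx.
by rewrite det_SL2.
Qed.

Lemma trace_word (w : seq 'I_3) :
  inv_fun (trace_inv R w) = \tr (\prod_(i <- w) gen_mx i).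
Proof.
apply/funext => rho; rewrite -[RHS]/(at_rep rho _) -trace_map_mx.
rewrite rmorph_prod /= /word_trace /word_mx; congr (\tr _).
by apply: eq_bigr => i _; rewrite map_gen_mx.
Qed.

Definition tcoord rho : 'I_6 -> C := fun k => trace_coord R k rho.

Definition t123 : inv_ring R := trace_inv R [:: 0; 1; 2].

Definition coord_span : {pred K} :=
  [pred f | `[< exists p q : {mpoly C[6]},
     forall rho, f rho = p.@[tcoord rho] + q.@[tcoord rho] * t123 rho >]].

Lemma tcoordE rho :
  [/\ tcoord rho 0 = \tr (SL2_mx (rho 0)), tcoord rho 1 = \tr (SL2_mx (rho 1)),
      tcoord rho 2 = \tr (SL2_mx (rho 2)),
      tcoord rho 3 = \tr (SL2_mx (rho 0) *m SL2_mx (rho 1)) &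
   [/\ tcoord rho 4 = \tr (SL2_mx (rho 1) *m SL2_mx (rho 2)),
      tcoord rho 5 = \tr (SL2_mx (rho 0) *m SL2_mx (rho 2)) &
      t123 rho = \tr (SL2_mx (rho 0) *m SL2_mx (rho 1) *m SL2_mx (rho 2))]].
Proof.
by split; [..|split]; rewrite /tcoord /= /word_trace /word_mx
  ?(tnth_nth [::]) /= !big_cons big_nil ?mulr1 -?mulmxE ?mulmxA.
Qed.

Lemma t123_quadratic rho : t123 rho ^+ 2 =
  fricke_sum (tcoord rho) * t123 rho - fricke_prod (tcoord rho).
Proof.
have [E0 E1 E2 E3 [E4 E5 E6]] := tcoordE rho.
have := fricke_product (det_SL2 (rho 0)) (det_SL2 (rho 1)) (det_SL2 (rho 2)).
rewrite -E0 -E1 -E2 -E3 -E4 -E5 -E6 /fricke_sum /fricke_prod => <-; ring.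
Qed.

Lemma meval_fricke_sum v :
  (fricke_sum (fun k => 'X_k : {mpoly C[6]})).@[v] = fricke_sum v.
Proof. by rewrite rmorph_fricke_sum /fricke_sum /= !mevalXU. Qed.

Lemma meval_fricke_prod v :
  (fricke_prod (fun k => 'X_k : {mpoly C[6]})).@[v] = fricke_prod v.
Proof. by rewrite rmorph_fricke_prod /fricke_prod /= !mevalXU. Qed.

(** Closure under products is the quadratic equation of t123. *)
Fact coord_span_subring : subring_closed coord_span.
Proof.
split=> [|f h|f h].
- apply/asboolP; exists 1, 0 => rho; by rewrite meval1 meval0 mul0r addr0.
- move=> /asboolP[p [q E]] /asboolP[p' [q' E']]; apply/asboolP.
  exists (p - p'), (q - q') => rho; rewrite -[LHS]/(f rho - h rho) E E' !mevalB.
  ring.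
- move=> /asboolP[p [q E]] /asboolP[p' [q' E']]; apply/asboolP.
  have := meval_fricke_prod; have := meval_fricke_sum.
  move: (fricke_sum _) (fricke_prod _) => s m sE mE.
  exists (p * p' - q * q' * m), (p * q' + q * p' + q * q' * s) => rho.
  rewrite -[LHS]/(f rho * h rho) E E' !(mevalB, mevalD, mevalM) sE mE.
  transitivity (p.@[tcoord rho] * p'.@[tcoord rho] +
    (p.@[tcoord rho] * q'.@[tcoord rho] + q.@[tcoord rho] * p'.@[tcoord rho]) * t123 rho
    + q.@[tcoord rho] * q'.@[tcoord rho] * t123 rho ^+ 2); first by ring.
  by rewrite t123_quadratic; ring.
Qed.

HB.instance Definition _ :=
  GRing.isSubringClosed.Build K coord_span coord_span_subring.

Lemma coord_span_const (c : C) : (fun=> c) \in coord_span.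
Proof. by apply/asboolP; exists c%:MP, 0 => rho; rewrite mevalC meval0 mul0r addr0. Qed.

Lemma coord_span_coord k : inv_fun (trace_coord R k) \in coord_span.
Proof. by apply/asboolP; exists 'X_k, 0 => rho; rewrite mevalXU meval0 mul0r addr0. Qed.

Lemma coord_span_t123 : inv_fun t123 \in coord_span.
Proof. by apply/asboolP; exists 0, 1 => rho; rewrite meval1 meval0 mul1r add0r. Qed.

Definition gen_span := word_span coord_span (gen_mx 0) (gen_mx 1) (gen_mx 2).

Lemma gen_span_closed :
  (forall U V, gen_span U -> gen_span V -> gen_span (U *m V)) /\
  (forall U, gen_span U -> \tr U \in coord_span).
Proof.
have E k := coord_span_coord k.
have T0 : \tr (gen_mx 0) \in coord_span.
  by have := E 0; rewrite trace_word (tnth_nth [::]) /= big_seq1.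
have T1 : \tr (gen_mx 1) \in coord_span.
  by have := E 1; rewrite trace_word (tnth_nth [::]) /= big_seq1.
have T2 : \tr (gen_mx 2) \in coord_span.
  by have := E 2; rewrite trace_word (tnth_nth [::]) /= big_seq1.
have T3 : \tr (gen_mx 0 *m gen_mx 1) \in coord_span.
  by have := E 3; rewrite trace_word (tnth_nth [::]) /= !big_cons big_nil mulr1.
have T4 : \tr (gen_mx 1 *m gen_mx 2) \in coord_span.
  by have := E 4; rewrite trace_word (tnth_nth [::]) /= !big_cons big_nil mulr1.
have T5 : \tr (gen_mx 0 *m gen_mx 2) \in coord_span.
  by have := E 5; rewrite trace_word (tnth_nth [::]) /= !big_cons big_nil mulr1.
have T6 : \tr (gen_mx 0 *m gen_mx 1 *m gen_mx 2) \in coord_span.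
  by have := coord_span_t123; rewrite trace_word !big_cons big_nil mulr1 -mulmxA.
have D i := det_gen_mx i.
split=> U; first exact: (word_spanM (D 0) (D 1) (D 2) T0 T1 T2 T3 T4 T5).
exact: (word_span_trace T0 T1 T2 T3 T4 T5 T6).
Qed.

End CharacterRing.

(** * Invariants are polynomials in traces *)

Section InvariantTheory.
Variable R : realType.
Local Notation C := R[i].
Local Notation K := (rep R -> C).
Implicit Types (rho : rep R) (f : K).

Lemma gen_span_adj U : @gen_span R U -> gen_span (adj2 U).
Proof.
move=> Us; have [spanD spanZ] := Smodule_word_span (@coord_span R)
  (gen_mx R 0) (gen_mx R 1) (gen_mx R 2).
apply: (spanD); last exact: SmoduleN (Smodule_word_span _ _ _ _) Us.
exact/word_span_scalar/(gen_span_closed R).2.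
Qed.

Lemma gen_span_gen i : gen_span (gen_mx R i).
Proof.
have [s0 s1 s2] := word_span_gens (@coord_span R)
  (gen_mx R 0) (gen_mx R 1) (gen_mx R 2).
by case: i => [[|[|[|//]]] i3]; [move: s0 | move: s1 | move: s2];
  congr (word_span _ _ _ _ (gen_mx R _)); apply: val_inj.
Qed.

Section GenericMatrix.
Variables (n : nat) (gvar : 'I_2 -> 'I_2 -> 'I_n).
Hypothesis gvar_eq : forall i a j b,
  (gvar i a == gvar j b) = (i == j) && (a == b).

Local Notation rep_concomitant :=
  (concomitant gvar (@coord_span R) (@gen_span R)).

(** In a polynomial expression of an invariant function, these may replace the
    matrix entries of rho, up to powers of the determinant of G. *)
Definition conj_entry (k : 'I_#|{: 'I_3 * ('I_2 * 'I_2)}|) : {mpoly K[n]} :=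
  let: (i, (a, b)) := enum_val k in gconj gvar (gen_mx R i) a b.

Local Notation eval_rep rho v := (eval_at (at_rep rho) v).
Local Notation gmat := (gmat gvar).

Lemma eval_conj_entry rho v k : eval_rep rho v (conj_entry k) =
  let: (i, (a, b)) := enum_val k in (adj2 (gmat v) *m rho i *m gmat v) a b.
Proof.
by rewrite /conj_entry; case: (enum_val k) => i [a b]; rewrite eval_at_gconj map_gen_mx.
Qed.

(** The matrix G need not have determinant 1, but dividing it by a square root of
    its determinant brings it to SL2 without changing conjugation by it. *)
Lemma conj_invariant_gmat f rho v : f \in @inv_regular R -> \det (gmat v) != 0 ->
  forall P : {mpoly C[_]}, (forall rho, f rho = P.@[entries rho]) ->
  f rho = P.@[fun k => (\det (gmat v))^-1 * eval_rep rho v (conj_entry k)].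
Proof.
move=> /inv_regularP[_ finv] D0 P fP.
set D := \det (gmat v) in D0 *.
pose s := sqrtC D.
have s2 : s * s = D by rewrite -expr2 sqrtCK.
have mu : gmat v \in unitmx by rewrite unitmxE unitfE.
have adjE : adj2 (gmat v) = D *: invmx (gmat v).
  by rewrite -[LHS]mulmx1 -(mulmxV mu) mulmxA adj2_mul mul_scalar_mx.
have s0 : s != 0 by apply: contraNneq D0 => s0; rewrite -s2 s0 mul0r.
have hdet : \det (s *: invmx (gmat v)) == 1.
  by rewrite detZ det_inv expr2 s2 -/D mulfV.
pose h := MkSL2 hdet.
rewrite -(finv h rho) fP; apply: meval_eq => k.
rewrite eval_conj_entry /entries; case: (enum_val k) => i [a b] /=.
rewrite conj_scaled_inv // adjE -!scalemxAl.
by rewrite [in RHS]mxE mulrA mulVf // mul1r.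
Qed.

(** Identities between polynomials whose coefficients are functions of rho can be
    checked at each rho and, over C, where some nonzero polynomial d is nonzero. *)
Lemma mpoly_fun_eq (d p q : {mpoly K[n]}) :
    (forall rho, map_mpoly (at_rep rho) d != 0) ->
    (forall rho v, eval_rep rho v d != 0 -> eval_rep rho v p = eval_rep rho v q) ->
  p = q.
Proof.
move=> d0 H; apply/mpolyP => m; apply/funext => rho.
have E r : r@_m rho = (map_mpoly (at_rep rho) r)@_m by rewrite mcoeff_map_mpoly.
by rewrite !E (mpoly_dense_eq (d0 rho) (H rho)).
Qed.

Lemma gdet_neq0 rho : map_mpoly (at_rep rho) (gdet K gvar) != 0.
Proof.
(* This choice of values makes G the identity matrix. *)
pose v k : C := ((k == gvar 0 0) || (k == gvar 1 1))%:R.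
apply/eqP => d0; have := eval_at_gdet (at_rep rho) gvar v.
rewrite /eval_at /= d0 meval0.
suff -> : gmat v = 1%:M by rewrite det1 => /eqP; rewrite eq_sym oner_eq0.
by apply: matrix2P; rewrite !mxE /v !gvar_eq.
Qed.

(** This is [conj_invariant_gmat] with denominators cleared: a monomial of degree
    e in the entries of G^-1 X G has denominator det(G)^e. *)
Lemma inv_regular_expand f (P : {mpoly C[_]}) : f \in @inv_regular R ->
  (forall rho, f rho = P.@[entries rho]) ->
  f%:MP * gdet K gvar ^+ msize P = \sum_(m <- msupp P)
    ((fun=> P@_m) : K)%:MP * (gdet K gvar ^+ (msize P - mdeg m) *
       \prod_k conj_entry k ^+ m k).
Proof.
move=> finv fP; set N := msize P.
apply: (mpoly_fun_eq gdet_neq0) => rho v.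
rewrite eval_at_gdet => D0.
rewrite eval_atM eval_atC rmorphXn /= eval_at_gdet rmorph_sum /=.
rewrite -[at_rep rho f]/(f rho) (conj_invariant_gmat rho finv D0 fP).
rewrite mevalE mulr_suml.
rewrite big_seq [RHS]big_seq; apply: eq_bigr => m mP.
rewrite eval_atM eval_atC eval_atM rmorphXn /= eval_at_gdet rmorph_prod /= -mulrA.
congr (_ * _).
have {1}-> : N = (N - mdeg m + mdeg m)%N by rewrite subnK // ltnW // msize_mdeg_lt.
rewrite exprD mulrCA; congr (_ * _).
rewrite mdegE -prodrXr -big_split /=; apply: eq_bigr => k _.
rewrite rmorphXn /= -exprMn. by rewrite mulrC mulVKf.
Qed.

Lemma inv_regular_concomitant f (P : {mpoly C[_]}) : f \in @inv_regular R ->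
  (forall rho, f rho = P.@[entries rho]) ->
  rep_concomitant (f%:MP * gdet K gvar ^+ msize P).
Proof.
move=> finv fP; rewrite (inv_regular_expand finv fP).
have c1 : rep_concomitant 1 by rewrite -mpolyC1; apply/concomitantC/rpred1.
have cX p m : rep_concomitant p -> rep_concomitant (p ^+ m).
  by move=> cp; elim: m => [|m IHm]; rewrite ?expr0 // exprS; apply: concomitantM.
have s1 : gen_span (1%:M : 'M[K]_2) by apply/word_span_scalar/rpred1.
apply: big_ind => [|p q|m _]; first by rewrite -mpolyC0; apply/concomitantC/rpred0.
  exact: concomitantD.
apply: concomitantM; first exact/concomitantC/coord_span_const.
apply: concomitantM; first exact/cX/concomitant_form.
apply: big_ind => [//|p q|k _]; first exact: concomitantM.
apply: (cX); rewrite /conj_entry; case: (enum_val k) => i [a b].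
rewrite /gconj; apply: concomitantM; last exact/concomitant_form/gen_span_gen.
by apply: (cX); apply: concomitantN.
Qed.

End GenericMatrix.

(** The Omega process is applied to f det(G)^N, which is a concomitant because f
    is invariant; dividing by the resulting integer uses characteristic zero. *)
Lemma inv_regular_coord_span f : f \in @inv_regular R -> f \in @coord_span R.
Proof.
move=> finv; have /inv_regularP[[P fP] _] := finv.
pose gvar i j : 'I_#|{: 'I_2 * 'I_2}| := enum_rank (i, j).
have gvar_eq i a j b : (gvar i a == gvar j b) = (i == j) && (a == b).
  by rewrite (inj_eq enum_rank_inj) xpair_eqE.
have [N N0 NfS] := concomitant_invariant gvar_eq (gen_span_closed R).1 gen_span_adj
  (gen_span_closed R).2 (inv_regular_concomitant gvar_eq finv fP).
have -> : f = (fun=> N%:R^-1 : C) * (N%:R * f).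
  apply/funext => rho; rewrite -[RHS]/(N%:R^-1 * (at_rep rho N%:R * f rho)).
  by rewrite rmorph_nat mulKf // pnatr_eq0 -lt0n.
by rewrite rpredM // coord_span_const.
Qed.

End InvariantTheory.

(** * Linear independence of 1 and t123 *)

(** The left-hand side is tr (C B A) = tr (A C B). *)
Lemma trace_reverse (K : comNzRingType) (A B C : 'M[K]_2) :
  \tr (A^T *m B^T *m C^T) =
  \tr (A *m B) * \tr C + \tr (A *m C) * \tr B + \tr (B *m C) * \tr A
  - \tr A * \tr B * \tr C - \tr (A *m B *m C).
Proof. by rewrite !mxtrace2 !mulmx2E !mxE; ring. Qed.

Definition mx2 (K : nzRingType) (a b c d : K) : 'M[K]_2 :=
  \matrix_(i, j) if i == 0 then (if j == 0 then a else b)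
                 else (if j == 0 then c else d).

(** Diagonalize A, with distinct eigenvalues since t1^2 <> 4, and scale the basis
    so that B has upper right entry 1. The traces with A determine the diagonals
    of B and C, and the off-diagonal entry w of B is a nonzero multiple of the
    second hypothesis. Then t23 and the determinant of C amount to a quadratic
    equation for q, with leading coefficient w. *)
Lemma generic_triple (F : numClosedFieldType) (t1 t2 t3 t12 t23 t13 : F) :
    t1 ^+ 2 - 4 != 0 ->
    t1 ^+ 2 + t2 ^+ 2 + t12 ^+ 2 - t1 * t2 * t12 - 4 != 0 ->
  exists A B C : 'M[F]_2,
  [/\ \det A = 1, \det B = 1 & \det C = 1] /\
  [/\ [/\ \tr A = t1, \tr B = t2 & \tr C = t3],
      \tr (A *m B) = t12, \tr (B *m C) = t23 & \tr (A *m C) = t13].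
Proof.
move=> h1 h2.
pose dl := sqrtC (t1 ^+ 2 - 4).
have dl2 : dl ^+ 2 = t1 ^+ 2 - 4 by rewrite sqrtCK.
have dl0 : dl != 0 by rewrite sqrtC_eq0.
(* The eigenvalues of A. *)
pose l := (t1 + dl) / 2; pose m := (t1 - dl) / 2.
have lm1 : l * m = 1.
  have -> : l * m = (t1 ^+ 2 - dl ^+ 2) / 4 by rewrite /l /m; field.
  by rewrite dl2; field.
have lmD : l + m = t1 by rewrite /l /m; field.
have lmB : l - m = dl by rewrite /l /m; field.
pose a := (t12 - m * t2) / dl; pose d := (l * t2 - t12) / dl.
pose p := (t13 - m * t3) / dl; pose s := (l * t3 - t13) / dl.
have adD : a + d = t2 by rewrite /a /d -lmB; field; rewrite lmB.
have psD : p + s = t3 by rewrite /p /s -lmB; field; rewrite lmB.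
have adL : l * a + m * d = t12 by rewrite /a /d -lmB; field; rewrite lmB.
have psL : l * p + m * s = t13 by rewrite /p /s -lmB; field; rewrite lmB.
pose w := a * d - 1.
have w0 : w != 0.
  suff E : w * dl ^+ 2 = - (t1 ^+ 2 + t2 ^+ 2 + t12 ^+ 2 - t1 * t2 * t12 - 4).
    by apply: contraNneq h2 => w0; rewrite -oppr_eq0 -E w0 mul0r.
  have -> : w * dl ^+ 2 = (l + m) * t2 * t12 - t12 ^+ 2 - l * m * t2 ^+ 2 - dl ^+ 2.
    by rewrite /w /a /d; field.
  by rewrite dl2 lmD lm1; ring.
pose e := t23 - a * p - d * s.
pose q := (e + sqrtC (e ^+ 2 - 4 * w * (p * s - 1))) / (2 * w).
have qE : w * q ^+ 2 - e * q + (p * s - 1) = 0.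
  pose r := sqrtC (e ^+ 2 - 4 * w * (p * s - 1)).
  have r2 : r ^+ 2 = e ^+ 2 - 4 * w * (p * s - 1) by rewrite sqrtCK.
  have -> : w * q ^+ 2 - e * q + (p * s - 1) =
      (r ^+ 2 - e ^+ 2) / (4 * w) + (p * s - 1).
    by rewrite /q -/r; field.
  by rewrite r2; field.
exists (mx2 l 0 0 m), (mx2 a 1 w d), (mx2 p q (e - w * q) s).
rewrite !det2 !mxtrace2 !mulmx2E !mxE /=; split; split.
- by rewrite lm1; ring.
- by rewrite /w; ring.
- transitivity (w * q ^+ 2 - e * q + (p * s - 1) + 1); first by ring.
  by rewrite qE add0r.
- by split.
- by rewrite -adL; ring.
- by rewrite /e; ring.
- by rewrite -psL; ring.
Qed.

Lemma ord6_ind (P : 'I_6 -> Prop) :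
  P 0 -> P 1 -> P 2 -> P 3 -> P 4 -> P 5 -> forall k, P k.
Proof.
move=> P0 P1 P2 P3 P4 P5 [[|[|[|[|[|[|//]]]]]] k6];
  [move: P0|move: P1|move: P2|move: P3|move: P4|move: P5];
  by congr (P _); apply: val_inj.
Qed.

(** The first two factors make [generic_triple] applicable, and the third is the
    discriminant of the quadratic equation of t123. *)
Definition generic_discr (A : comNzRingType) (t : 'I_6 -> A) : A :=
  (t 0 ^+ 2 - 4) * (t 0 ^+ 2 + t 1 ^+ 2 + t 3 ^+ 2 - t 0 * t 1 * t 3 - 4)
  * (fricke_sum t ^+ 2 - 4 * fricke_prod t).

Lemma rmorph_generic_discr (A B : comNzRingType) (h : {rmorphism A -> B}) t :
  h (generic_discr t) = generic_discr (h \o t).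
Proof.
rewrite /generic_discr 2!rmorphM; congr (_ * _ * _).
- by rewrite rmorphB rmorphXn rmorph_nat.
- by rewrite rmorphB rmorph_nat rmorphB !rmorphD !rmorphXn !rmorphM.
- by rewrite rmorphB rmorphXn rmorphM rmorph_nat rmorph_fricke_sum rmorph_fricke_prod.
Qed.

Section CoordinateRing.
Variable R : realType.
Local Notation C := R[i].
Implicit Types (rho : rep R).

Fact det_tr_SL2 (A : SL2 R) : \det (SL2_mx A)^T == 1.
Proof. by rewrite det_tr det_SL2. Qed.

Definition tr_rep rho : rep R := fun i => MkSL2 (det_tr_SL2 (rho i)).

Lemma tcoord_tr_rep rho : tcoord (tr_rep rho) = tcoord rho.
Proof.
have [E0 E1 E2 E3 [E4 E5 E6]] := tcoordE rho.
have [F0 F1 F2 F3 [F4 F5 F6]] := tcoordE (tr_rep rho).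
have trM (A B : 'M[C]_2) : \tr (A^T *m B^T) = \tr (A *m B).
  by rewrite -trmx_mul mxtrace_tr mxtrace_mulC.
apply/funext; apply: ord6_ind.
- by rewrite F0 E0 mxtrace_tr.
- by rewrite F1 E1 mxtrace_tr.
- by rewrite F2 E2 mxtrace_tr.
- by rewrite F3 E3 trM.
- by rewrite F4 E4 trM.
- by rewrite F5 E5 trM.
Qed.

Lemma t123_tr_rep rho :
  t123 R (tr_rep rho) = fricke_sum (tcoord rho) - t123 R rho.
Proof.
have [E0 E1 E2 E3 [E4 E5 E6]] := tcoordE rho.
have [_ _ _ _ [_ _ F6]] := tcoordE (tr_rep rho).
by rewrite F6 trace_reverse /fricke_sum E0 E1 E2 E3 E4 E5 E6.
Qed.

Definition generic_poly : {mpoly C[6]} := generic_discr (fun k => 'X_k).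

Lemma generic_poly_eval (t : 'I_6 -> C) : generic_poly.@[t] = generic_discr t.
Proof.
rewrite rmorph_generic_discr; congr generic_discr.
by apply/funext => k; rewrite /= mevalXU.
Qed.

Lemma generic_poly_neq0 : generic_poly != 0.
Proof.
apply/eqP => /(congr1 (meval (fun=> 0))); rewrite generic_poly_eval meval0.
(* At the origin the factors are -4, -4 and 16. *)
have -> : generic_discr (fun=> 0) = 256 :> C.
  by rewrite /generic_discr /fricke_sum /fricke_prod; ring.
by move/eqP; rewrite pnatr_eq0.
Qed.

Lemma generic_rep (t : 'I_6 -> C) : generic_poly.@[t] != 0 ->
  exists rho, tcoord rho = t.
Proof.
rewrite generic_poly_eval /generic_discr !mulf_eq0 !negb_or.
move=> /andP[/andP[h1 h2] _].
have [A0 [A1 [A2 [[d0 d1 d2] [[E0 E1 E2] E3 E4 E5]]]]] :=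
  generic_triple (t 2) (t 4) (t 5) h1 h2.
move/eqP: d0 => d0; move/eqP: d1 => d1; move/eqP: d2 => d2.
pose rho : rep R := fun i =>
  if i == 0 then MkSL2 d0 else if i == 1 then MkSL2 d1 else MkSL2 d2.
have [F0 F1 F2 F3 [F4 F5 F6]] := tcoordE rho.
by exists rho; apply/funext; apply: ord6_ind;
  rewrite ?F0 ?F1 ?F2 ?F3 ?F4 ?F5.
Qed.

(** Comparing the relation at rho and at its transpose gives q (2 y - S) = 0 with
    the same t, and 2 y - S is a square root of the discriminant. *)
Lemma coord_independent (p q : {mpoly C[6]}) :
    (forall rho, p.@[tcoord rho] + q.@[tcoord rho] * t123 R rho = 0) ->
  p = 0 /\ q = 0.
Proof.
move=> H.
have q0 : q = 0.
  apply: (mpoly_dense_eq0 generic_poly_neq0) => v gv.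
  have [rho E] := generic_rep gv.
  have H1 := H rho; have := H (tr_rep rho).
  rewrite tcoord_tr_rep t123_tr_rep; rewrite E in H1 * => H2.
  have := t123_quadratic rho; rewrite E; set y := t123 R rho => yE.
  have : q.@[v] * (2 * y - fricke_sum v) = 0.
    rewrite -[RHS](subrr 0) -{1}H1 -H2 /y; ring.
  move/eqP; rewrite mulf_eq0 => /orP[/eqP //|/eqP D0].
  suff D : fricke_sum v ^+ 2 - 4 * fricke_prod v = 0.
    by case/negP: gv; rewrite generic_poly_eval /generic_discr D mulr0.
  transitivity ((2 * y - fricke_sum v) ^+ 2); last by rewrite D0 expr0n.
  by rewrite -[fricke_prod v](subKr (fricke_sum v * y)) -yE; ring.
split=> //; apply: (mpoly_dense_eq0 generic_poly_neq0) => v gv.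
have [rho E] := generic_rep gv.
by have := H rho; rewrite E q0 meval0 mul0r addr0.
Qed.
End CoordinateRing.

(** * Points of the character variety *)

Section AffinePoints.
Variables (R : realType) (A : lalgType R[i]).

Lemma points_eq (x y : points A) : (forall f, x f = y f) -> x = y.
Proof.
case: x y => [f [[f1] [f2] [f3]]] [g [[g1] [g2] [g3]]] /= /funext E.
by case: _ / E in g1 g2 g3 *; rewrite (Prop_irrelevance f1 g1)
  (Prop_irrelevance f2 g2) (Prop_irrelevance f3 g3).
Qed.

Lemma point_pullback n (a : 'I_n -> A) (p : {mpoly R[i][n]}) (x : points A) :
  x (pullback a p) = p.@[fun k => x (a k)].
Proof.
rewrite /pullback /mmap raddf_sum mevalE; apply: eq_bigr => m _.
rewrite /= mulr_algl linearZ /= rmorph_prod /=; congr (_ * _).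
by apply: eq_bigr => k _; rewrite rmorphXn.
Qed.
End AffinePoints.

Section CharacterVarietyPoints.
Variable R : realType.
Local Notation C := R[i].
Implicit Types (rho : rep R) (f : inv_ring R) (z : 'I_6 -> C).

Lemma pullback_rep (p : {mpoly C[6]}) rho :
  pullback (@trace_coord R) p rho = p.@[tcoord rho].
Proof. exact: (point_pullback _ _ (rep_class rho)). Qed.

Lemma coeffs_exist f : exists pq : {mpoly C[6]} * {mpoly C[6]},
  forall rho, f rho = pq.1.@[tcoord rho] + pq.2.@[tcoord rho] * t123 R rho.
Proof.
have /asboolP[p [q E]] := inv_regular_coord_span (valP f).
by exists (p, q).
Qed.

(** The coordinates of f in the basis 1, t123. *)
Definition coeffs f := projT1 (cid (coeffs_exist f)).

Lemma coeffsP f rho :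
  f rho = (coeffs f).1.@[tcoord rho] + (coeffs f).2.@[tcoord rho] * t123 R rho.
Proof. exact: (projT2 (cid (coeffs_exist f))). Qed.

Lemma coeffs_unique f p q :
  (forall rho, f rho = p.@[tcoord rho] + q.@[tcoord rho] * t123 R rho) ->
  coeffs f = (p, q).
Proof.
move=> H; have [] := @coord_independent R ((coeffs f).1 - p) ((coeffs f).2 - q).
  move=> rho; rewrite !mevalB mulrBl addrACA -opprD.
  by rewrite -coeffsP -H subrr.
by case: (coeffs f) => p' q' /= /eqP + /eqP; rewrite !subr_eq0 => /eqP-> /eqP->.
Qed.

Lemma inv_ring_eq f (h : inv_ring R) : (forall rho, f rho = h rho) -> f = h.
Proof. by move=> E; apply/val_inj/funext. Qed.

Lemma coeffs_pullback f :
  f = pullback (@trace_coord R) (coeffs f).1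
      + pullback (@trace_coord R) (coeffs f).2 * t123 R.
Proof.
apply: inv_ring_eq => rho.
rewrite -[RHS]/(pullback (@trace_coord R) (coeffs f).1 rho
      + pullback (@trace_coord R) (coeffs f).2 rho * t123 R rho).
by rewrite !pullback_rep -coeffsP.
Qed.

Definition root_over z (y : C) : Prop := y ^+ 2 = fricke_sum z * y - fricke_prod z.

(** The point where the coordinates are z and t123 is y. The proof that y is a root
    is an argument so that it is available to the morphism instances. *)
Definition point_fun z (y : C) (_ : root_over z y) f : C :=
  (coeffs f).1.@[z] + (coeffs f).2.@[z] * y.

Section PointEval.
Variables (z : 'I_6 -> C) (y : C) (zy : root_over z y).

Fact point_fun_linear : scalar (point_fun zy).
Proof.
move=> a f h; rewrite /point_fun (@coeffs_unique (a *: f + h)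
  (a *: (coeffs f).1 + (coeffs h).1) (a *: (coeffs f).2 + (coeffs h).2)) /=.
  by rewrite !mevalD !mevalZ; ring.
move=> rho; rewrite -[LHS]/(a * f rho + h rho) !mevalD !mevalZ.
by rewrite (coeffsP f) (coeffsP h); ring.
Qed.

Fact point_fun_monoid_morphism : monoid_morphism (point_fun zy).
Proof.
split=> [|f h]; rewrite /point_fun.
  rewrite (@coeffs_unique 1 1 0) /=; first by rewrite meval1 meval0 mul0r addr0.
  by move=> rho; rewrite meval1 meval0 mul0r addr0.
have sE := meval_fricke_sum (R := R); have mE := meval_fricke_prod (R := R).
move: (fricke_sum _) (fricke_prod _) sE mE => s m sE mE.
rewrite (@coeffs_unique (f * h)
  ((coeffs f).1 * (coeffs h).1 - (coeffs f).2 * (coeffs h).2 * m)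
  ((coeffs f).1 * (coeffs h).2 + (coeffs f).2 * (coeffs h).1
   + (coeffs f).2 * (coeffs h).2 * s)) /=.
  rewrite !(mevalB, mevalD, mevalM) sE mE.
  move: zy; rewrite /root_over; set S := fricke_sum z; set P := fricke_prod z.
  move=> yE; have -> : P = S * y - y ^+ 2 by rewrite yE; ring.
  ring.
move=> rho; rewrite -[LHS]/(f rho * h rho) (coeffsP f) (coeffsP h).
rewrite !(mevalB, mevalD, mevalM) sE mE.
have := t123_quadratic rho; set S := fricke_sum _; set P := fricke_prod _.
set t := t123 R rho; move=> tE; have -> : P = S * t - t ^+ 2 by rewrite tE; ring.
ring.
Qed.

HB.instance Definition _ := GRing.isLinear.Build C (inv_ring R) C *%R
  (point_fun zy) point_fun_linear.
HB.instance Definition _ := GRing.isMonoidMorphism.Build (inv_ring R) C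
  (point_fun zy) point_fun_monoid_morphism.

Definition point_over : V3 R := point_fun zy.

Lemma point_over_coord k : point_over (trace_coord R k) = z k.
Proof.
rewrite -[LHS]/(point_fun zy _) /point_fun (@coeffs_unique _ 'X_k 0) /=.
  by rewrite mevalXU meval0 mul0r addr0.
by move=> rho; rewrite mevalXU meval0 mul0r addr0.
Qed.

Lemma point_over_t123 : point_over (t123 R) = y.
Proof.
rewrite -[LHS]/(point_fun zy _) /point_fun (@coeffs_unique _ 0 1) /=.
  by rewrite meval0 meval1 mul1r add0r.
by move=> rho; rewrite meval0 meval1 mul1r add0r.
Qed.
End PointEval.

Lemma point_t123 (x : V3 R) : root_over (fun k => x (trace_coord R k)) (x (t123 R)).
Proof.
rewrite /root_over.
have E : t123 R ^+ 2 =
    fricke_sum (@trace_coord R) * t123 R - fricke_prod (@trace_coord R).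
  apply: inv_ring_eq => rho.
  rewrite -[LHS]/(class_fun rho _) -[RHS]/(class_fun rho _).
  rewrite rmorphXn rmorphB rmorphM rmorph_fricke_sum rmorph_fricke_prod.
  exact: t123_quadratic.
by rewrite -rmorphXn E rmorphB rmorphM rmorph_fricke_sum rmorph_fricke_prod.
Qed.

Lemma point_eq_over (x x' : V3 R) :
  (forall k, x (trace_coord R k) = x' (trace_coord R k)) ->
  x (t123 R) = x' (t123 R) -> x = x'.
Proof.
move=> Et Ey; apply: points_eq => f; rewrite (coeffs_pullback f).
have E (w : V3 R) p q : w (pullback (@trace_coord R) p
    + pullback (@trace_coord R) q * t123 R) =
    p.@[fun k => w (trace_coord R k)]
    + q.@[fun k => w (trace_coord R k)] * w (t123 R).
  by rewrite rmorphD rmorphM -!point_pullback.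
by rewrite !E Ey; congr (_ + _ * _); apply: meval_eq.
Qed.

Lemma finite_flat_trace_coord : finite_flat_of_degree 2 (@trace_coord R).
Proof.
exists (fun j => if j == 0 then 1 else t123 R) => f.
have E (c : {ffun 'I_2 -> {mpoly C[6]}}) rho :
    (\sum_(j < 2) pullback (@trace_coord R) (c j)
       * (if j == 0 then 1 else t123 R)) rho
    = (c 0).@[tcoord rho] + (c 1).@[tcoord rho] * t123 R rho.
  by rewrite big_ord2 /= mulr1 -!pullback_rep.
exists [ffun j => if j == 0 then (coeffs f).1 else (coeffs f).2]; split.
  by apply: inv_ring_eq => rho; rewrite E !ffunE -coeffsP.
move=> c fc; rewrite (@coeffs_unique f (c 0) (c 1)); last first.
  by move=> rho; rewrite -E -fc.
by apply/ffunP => j; rewrite ffunE; case: (ord2P j) => ->.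
Qed.

Lemma affine_map_eq (x : V3 R) (z : 'rV[C]_6) :
  affine_map (@trace_coord R) x = z <-> (forall k, x (trace_coord R k) = z 0 k).
Proof.
split=> [<- k|E]; first by rewrite mxE.
by apply/rowP => k; rewrite mxE E.
Qed.

Lemma discriminant_locusP (z : 'rV[C]_6) : discriminant_locus z <->
  fricke_sum (z 0) ^+ 2 = 4 * fricke_prod (z 0).
Proof. by []. Qed.

(** Completing the square. *)
Lemma root_overE (z : 'I_6 -> C) y :
  root_over z y <->
  (2 * y - fricke_sum z) ^+ 2 = fricke_sum z ^+ 2 - 4 * fricke_prod z.
Proof.
rewrite /root_over; move: (fricke_sum z) (fricke_prod z) => s p; split=> [E|E].
  have -> : p = s * y - y ^+ 2 by rewrite E; ring.
  ring.
have -> : y ^+ 2 = ((2 * y - s) ^+ 2 - s ^+ 2) / 4 + s * y by field.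
by rewrite E; field.
Qed.

Lemma fiberP (z : 'rV[C]_6) (x : V3 R) : fiber (@trace_coord R) z x ->
  root_over (z 0) (x (t123 R)).
Proof.
move=> /affine_map_eq E; have := point_t123 x.
by rewrite (_ : (fun k => _) = z 0) //; apply/funext.
Qed.

Lemma point_over_fiber (z : 'rV[C]_6) y (zy : root_over (z 0) y) :
  fiber (@trace_coord R) z (point_over zy).
Proof. by apply/affine_map_eq => k; rewrite point_over_coord. Qed.

Lemma fiber_point_over (z : 'rV[C]_6) (x : V3 R) y (zy : root_over (z 0) y) :
  fiber (@trace_coord R) z x -> x (t123 R) = y -> x = point_over zy.
Proof.
move=> /affine_map_eq E Ey; apply: point_eq_over => [k|].
  by rewrite E point_over_coord.
by rewrite point_over_t123.
Qed.

End CharacterVarietyPoints.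

Theorem proposition5p1p1 (R : realType) :
  (forall z : 'rV[R[i]]_6, exists x : V3 R, trace_map x = z) /\
  double_covering_branched_along (@trace_coord R) (@discriminant_locus R).
Proof.
pose s (z : 'rV[R[i]]_6) := fricke_sum (z 0).
pose dl (z : 'rV[R[i]]_6) := sqrtC (s z ^+ 2 - 4 * fricke_prod (z 0)).
have dlE (z : 'rV[R[i]]_6) : dl z ^+ 2 = s z ^+ 2 - 4 * fricke_prod (z 0).
  by rewrite sqrtCK.
have root1 (z : 'rV[R[i]]_6) : root_over (z 0) ((s z + dl z) / 2).
  by apply/root_overE; rewrite -dlE -/(s z); field.
have root2 (z : 'rV[R[i]]_6) : root_over (z 0) ((s z - dl z) / 2).
  by apply/root_overE; rewrite -dlE -/(s z); field.
have rootP (z : 'rV[R[i]]_6) y : root_over (z 0) y ->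
    y = (s z + dl z) / 2 \/ y = (s z - dl z) / 2.
  move=> /root_overE; rewrite -dlE -/(s z) => /eqP; rewrite eqf_sqr.
  by case/orP => /eqP E; [left | right]; rewrite -E; field.
split; first by move=> z; exists (point_over (root1 z)); exact: point_over_fiber.
split; first exact: finite_flat_trace_coord.
- move=> z Dz.
  have dl0 : dl z != 0.
    apply/eqP => d0; apply/Dz/discriminant_locusP/eqP.
    by rewrite -subr_eq0 -dlE d0 expr0n.
  pose F (n : nat) :=
    if n == 0%N then point_over (root1 z) else point_over (root2 z).
  have -> : fiber (@trace_coord R) z = (F @` `I_2)%classic.
    apply/seteqP; split=> [x zx|_ [n _ <-]]; last first.
      by rewrite /F; case: ifP => _; exact: point_over_fiber.
    have [E|E] := rootP _ _ (fiberP zx).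
      by exists 0%N => //; rewrite /F eqxx; apply/esym/fiber_point_over.
    by exists 1%N => //; apply/esym/fiber_point_over.
  apply: inj_card_eq => i j; rewrite !inE /=.
  have ne : point_over (root1 z) <> point_over (root2 z).
    move=> /(congr1 (fun x : V3 R => x (t123 R))).
    rewrite !point_over_t123 => E; case/eqP: dl0.
    transitivity ((s z + dl z) / 2 - (s z - dl z) / 2); first by field.
    by rewrite E subrr.
  by case: i j => [|[|i]] [|[|j]] // _ _; rewrite /F => e; case: ne.
- move=> z /discriminant_locusP Dz.
  have dl0 : dl z = 0 by rewrite /dl /s Dz subrr sqrtC0.
  have -> : fiber (@trace_coord R) z = [set point_over (root1 z)]%classic.
    apply/seteqP; split=> [x zx|_ ->]; last exact: point_over_fiber.
    apply: fiber_point_over => //; have [//|->] := rootP _ _ (fiberP zx).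
    by rewrite dl0 subr0 addr0.
  exact: card_set1.
Qed.
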